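(* Let $n\ge 3$, let $A_0,A_1,A_2\in\mathbb{R}^{n\times n}$ be symmetric matrices and put $q_i(x)=x^TA_ix$ for $i=0,1,2$. Suppose that there exist $\mu_1,\mu_2\in\mathbb{R}$ with $\mu_1A_1+\mu_2A_2\succ 0$, and that there exists $x^0\in\mathbb{R}^n$ with $q_1(x^0)=1$ and $q_2(x^0)<1$. Let $x^*$ be a local non-global minimizer of $$\min_{x\in\mathbb{R}^n}\{q_0(x):\ q_1(x)=1,\ q_2(x)\le 1\}.$$ Then there exist $\alpha\in\mathbb{R}$ and $\beta>0$ such that $$(A_0+\alpha A_1+\beta A_2)x^*=0,\quad q_1(x^* )=1,\quad q_2(x^* )\le 1,\quad \beta(q_2(x^* )-1)=0,$$ and for such $\alpha,\beta$ the matrix $A_0+\alpha A_1+\beta A_2$ has exactly one negative eigenvalue.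
   Context: $M\succ 0$ means that the symmetric matrix $M$ is positive definite. A local non-global minimizer is a local minimizer that is not a global minimizer. Eigenvalues are counted with multiplicity. *)

(* Defs.v *)
From HB Require Import structures.
From mathcomp Require Import all_boot all_order all_algebra.
From mathcomp Require Import all_classical all_reals all_analysis.

Set Implicit Arguments.
Unset Strict Implicit.
Unset Printing Implicit Defensive.

Import Order.TTheory GRing.Theory Num.Theory.
Import numFieldNormedType.Exports.

Local Open Scope classical_set_scope.
Local Open Scope ring_scope.

Definition qform (R : realType) (n : nat) (A : 'M[R]_n) (x : 'cV[R]_n) : R :=
  (x^T *m A *m x) 0 0.

Definition posdefmx (R : realType) (n : nat) (M : 'M[R]_n) : Prop :=
  M^T = M /\ forall x : 'cV[R]_n, x != 0 -> 0 < qform M x.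

Definition global_minimizer (R : realType) (T : Type) (f : T -> R)
    (D : set T) (x : T) : Prop :=
  D x /\ forall y, D y -> f x <= f y.

Definition local_minimizer (R : realType) (T : topologicalType) (f : T -> R)
    (D : set T) (x : T) : Prop :=
  D x /\ \forall y \near x, D y -> f x <= f y.

Definition local_nonglobal_minimizer (R : realType) (T : topologicalType)
    (f : T -> R) (D : set T) (x : T) : Prop :=
  local_minimizer f D x /\ ~ global_minimizer f D x.

(* The list s consists of the roots of the characteristic polynomial, repeated
   according to algebraic multiplicity.  Such an s exists for every real
   symmetric M, and it is unique up to permutation. *)
Definition num_neg_eigenvalues (R : realType) (n : nat) (M : 'M[R]_n)
    (k : nat) : Prop :=
  exists2 s : seq R, char_poly M = \prod_(a <- s) ('X - a%:P)
    & count (fun a => a < 0) s = k.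

Definition feasible (R : realType) (n : nat) (A1 A2 : 'M[R]_n) :
    set 'cV[R]_n :=
  [set x | qform A1 x = 1 /\ qform A2 x <= 1].

Definition kkt (R : realType) (n : nat) (A0 A1 A2 : 'M[R]_n) (x : 'cV[R]_n)
    (alpha beta : R) : Prop :=
  [/\ (A0 + alpha *: A1 + beta *: A2) *m x = 0,
      qform A1 x = 1,
      qform A2 x <= 1
    & beta * (qform A2 x - 1) = 0].

(* Main.v *)
Require Import Defs.
From HB Require Import structures.
From mathcomp Require Import all_boot all_order all_algebra.
From mathcomp Require Import complex.
From mathcomp Require Import all_classical all_reals all_analysis.
From mathcomp Require Import ring lra.

(** Because the data are quadratic forms, the problem is first made homogeneous.
    With [F = A0 - q0(x) A1] and [G = A2 - A1], rescaling shows that [x] is a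
    local minimizer only if [q_F >= 0] on the part of a neighbourhood of [x]
    where [q_G <= 0] ([local_minimizer_homogeneous]), while failure of global
    minimality gives a [y] with [q_G(y) <= 0] and [q_F(y) < 0].  Moreover
    [q_F(x) = 0] and [q_G(x) <= 0].

    Testing along curves [x + t w + t^2 z] as [t] decreases to 0, every
    degenerate situation makes [x] global, by the symmetry [w -> - w] of
    quadratic forms: the constraint must be active ([constraint_active]), its
    gradient [p = G x] must be nonzero ([constraint_normal_neq0]), and the
    multiplier [b] in [F x + b p = 0], whose existence and sign come from a
    one-inequality Farkas lemma, must be positive ([multiplier_gt0]).  Since
    [F + b G = A0 - (q0(x) + b) A1 + b A2], these are the required multipliers;
    conversely any admissible pair with a positive second entry has this form.

    Curves tangent to the boundary, bent by a suitable normal term [z], show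
    that [H = F + b G] is nonnegative on the hyperplane orthogonal to [p]
    ([lagrangian_tangent_ge0]), so that [H] has at most one negative eigenvalue.
    It has at least one, since [q_H(y) <= q_F(y) < 0]
    ([one_negative_eigenvalue]).  The count rests on the unitary diagonalization
    of [H] over the complex numbers, whose eigenvalues are real. *)

Set Implicit Arguments.
Unset Strict Implicit.
Unset Printing Implicit Defensive.

Import Order.TTheory GRing.Theory Num.Theory.
Import numFieldNormedType.Exports.

Local Open Scope classical_set_scope.
Local Open Scope ring_scope.

(** * Dot product and quadratic forms *)

Section Forms.
Context {R : realType} {n : nat}.
Implicit Types (A : 'M[R]_n) (f p u v w x z : 'cV[R]_n) (a b t : R).

Definition dot u v : R := (u^T *m v) 0 0.

Lemma dotE u v : dot u v = \sum_i u i 0 * v i 0.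
Proof. by rewrite /dot mxE; apply: eq_bigr => i _; rewrite mxE. Qed.

Lemma dotC u v : dot u v = dot v u.
Proof. by rewrite !dotE; apply: eq_bigr => i _; rewrite mulrC. Qed.

Lemma dotDr u v w : dot u (v + w) = dot u v + dot u w.
Proof. by rewrite /dot mulmxDr mxE. Qed.

Lemma dotZr a u v : dot u (a *: v) = a * dot u v.
Proof. by rewrite /dot -scalemxAr mxE. Qed.

Lemma dotDl u v w : dot (u + v) w = dot u w + dot v w.
Proof. by rewrite !(dotC _ w) dotDr. Qed.

Lemma dotZl a u v : dot (a *: u) v = a * dot u v.
Proof. by rewrite !(dotC _ v) dotZr. Qed.

Lemma dot0l u : dot 0 u = 0.
Proof. by rewrite /dot trmx0 mul0mx mxE. Qed.

Lemma dot_ge0 u : 0 <= dot u u.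
Proof. by rewrite dotE sumr_ge0 // => i _; rewrite -expr2 sqr_ge0. Qed.

Lemma dot_eq0 u : (dot u u == 0) = (u == 0).
Proof.
apply/eqP/eqP => [|->]; last exact: dot0l.
rewrite dotE => /psumr_eq0P u0; apply/colP => i; rewrite mxE.
by apply/eqP; rewrite -sqrf_eq0 expr2 u0 // => j _; rewrite -expr2 sqr_ge0.
Qed.

Lemma dot_gt0 u : (0 < dot u u) = (u != 0).
Proof. by rewrite lt_neqAle eq_sym dot_eq0 dot_ge0 andbT. Qed.

Lemma qformE A u : qform A u = dot (A *m u) u.
Proof. by rewrite dotC /qform /dot mulmxA. Qed.

Lemma qform_lin A B a u : qform (A + a *: B) u = qform A u + a * qform B u.
Proof. by rewrite !qformE mulmxDl -scalemxAl dotDl dotZl. Qed.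

Lemma qformZ A a u : qform A (a *: u) = a ^+ 2 * qform A u.
Proof. by rewrite !qformE -scalemxAr dotZl dotZr; ring. Qed.

Lemma qformN A u : qform A (- u) = qform A u.
Proof. by rewrite -scaleN1r qformZ sqrrN expr1n mul1r. Qed.

Lemma dot_sym A u v : A^T = A -> dot (A *m u) v = dot u (A *m v).
Proof. by move=> sA; rewrite /dot trmx_mul sA mulmxA. Qed.

Lemma qformD A u v : A^T = A ->
  qform A (u + v) = qform A u + 2 * dot (A *m u) v + qform A v.
Proof.
move=> sA; rewrite !qformE mulmxDr !dotDl !dotDr.
by rewrite (dot_sym v u) // (dotC v); ring.
Qed.

Lemma qform_curve A x w z t : A^T = A ->
  qform A (x + t *: (w + t *: z)) = qform A x + t * (2 * dot (A *m x) w)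
    + t ^+ 2 * (qform A w + 2 * dot (A *m x) z)
    + t ^+ 3 * (2 * dot (A *m w) z) + t ^+ 4 * qform A z.
Proof.
by move=> sA; rewrite qformD // qformZ qformD // qformZ !(dotZr, dotDr); ring.
Qed.

(** Farkas' lemma for a single inequality, which supplies the Lagrange
    multiplier.  The residual [r] of the orthogonal projection of [f] on [p]
    vanishes because [- r - d p] lies in the open half-space for every [d > 0],
    whence [dot r r <= - d (dot f p)]. *)
Lemma halfspace_multiplier f p : p != 0 ->
  (forall h, dot p h < 0 -> 0 <= dot f h) ->
  exists2 b, 0 <= b & f + b *: p = 0.
Proof.
move=> p0 hf.
have pp : 0 < dot p p by rewrite dot_gt0.
have fp : dot f p <= 0.
  have := hf (-1 *: p); rewrite !dotZr !mulN1r oppr_lt0 oppr_ge0; exact.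
pose b := - dot f p / dot p p; exists b.
  by rewrite divr_ge0 ?dot_ge0 // oppr_ge0.
set r := f + b *: p.
have pr : dot p r = 0.
  by rewrite dotDr dotZr (dotC p f) divfK ?gt_eqF // subrr.
have fr : dot f r = dot r r by rewrite [in RHS]dotDl dotZl pr mulr0 addr0.
apply/eqP; clearbody r; rewrite -dot_eq0 eq_le dot_ge0 andbT.
apply/ler_addgt0Pr => e e0.
pose d := e / (1 - dot f p); have d0 : 0 < d by rewrite divr_gt0 //; lra.
(* [d] is small enough for [- d (dot f p)] to stay below [e]. *)
have := hf (-1 *: r + (- d) *: p); rewrite !dotDr !dotZr pr fr.
have de : d * (1 - dot f p) = e by rewrite divfK // gt_eqF //; lra.
have dpp : 0 < d * dot p p by rewrite mulr_gt0.
rewrite mulr0 add0r mulNr oppr_lt0 => /(_ dpp); lra.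
Qed.

End Forms.

(** * Signs of polynomials to the right of 0 *)

Section Germs.
Context {R : realType}.

Lemma germ_lt0 (a b c d e : R) : a < 0 ->
  \forall t \near 0^'+,
    a + t * b + t ^+ 2 * c + t ^+ 3 * d + t ^+ 4 * e < 0.
Proof.
move=> a0; pose p := Poly [:: a; b; c; d; e].
have pE t : p.[t] = a + t * b + t ^+ 2 * c + t ^+ 3 * d + t ^+ 4 * e.
  by rewrite horner_Poly /=; ring.
have /cvg_at_right_filter pc : {for 0, continuous (horner p)}.
  exact: continuous_horner.
have p0 : p.[0] < 0 by rewrite pE; lra.
near=> t; rewrite -pE.
by near: t; exact: cvgr_lt pc _ p0.
Unshelve. all: by end_near. Qed.

Lemma germ_ge0 (a b c d e : R) :
  (\forall t \near 0^'+,
    0 <= a + t * b + t ^+ 2 * c + t ^+ 3 * d + t ^+ 4 * e) -> 0 <= a.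
Proof.
move=> h; rewrite leNgt; apply/negP => /(@germ_lt0 _ b c d e) h'.
have [t []] := filter_ex (filterI h h').
by rewrite leNgt => /negP.
Qed.

End Germs.

(** * Homogenisation of the local problem *)

Section Local.
Context {R : realType} {n : nat}.
Implicit Types (x w z y : 'cV[R]_n).

Lemma qform_continuous (A : 'M[R]_n) : continuous (qform A).
Proof.
have -> : qform A = fun y => \sum_i (\sum_j A i j * y j 0) * y i 0.
  by apply/funext => y; rewrite qformE dotE; apply: eq_bigr => i _; rewrite mxE.
have rowc i : continuous (fun y : 'cV[R]_n => \sum_j A i j * y j 0).
  apply: continuous_big => [|j _ y]; first exact: add_continuous.
  by apply: continuousM; [exact: cst_continuous|exact: coord_continuous].
apply: continuous_big => [|i _ y]; first exact: add_continuous.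
by apply: continuousM; [exact: rowc|exact: coord_continuous].
Qed.

Lemma curve_cvg x w z : x + t *: (w + t *: z) @[t --> (0 : R)^'+] --> x.
Proof.
have t0 : t @[t --> (0 : R)^'+] --> (0 : R).
  by apply: cvg_at_right_filter; exact: cvg_id.
have zz : w + t *: z @[t --> (0 : R)^'+] --> w + 0 *: z.
  by apply: cvgD; [exact: cvg_cst|exact: cvgZr_tmp].
rewrite -[X in _ --> X]addr0 -(scale0r (w + 0 *: z)).
by apply: cvgD; [exact: cvg_cst|exact: cvgZ].
Qed.

(** Since all three functions are quadratic forms, [q1 = 1] is only a
    normalization: a point [y] near [x] has [q1 y > 0], and [y / sqrt (q1 y)]
    is near [x] and satisfies [q1 = 1].  Feasibility of this rescaled point
    amounts to [q2 y <= q1 y], and comparison with [x] to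
    [q0 y >= q0 x * q1 y]; so the equality constraint disappears. *)
Lemma local_minimizer_homogeneous (A0 A1 A2 : 'M[R]_n) x :
  local_minimizer (qform A0) (feasible A1 A2) x ->
  \forall y \near x, qform (A2 - A1) y <= 0 ->
    0 <= qform (A0 - qform A0 x *: A1) y.
Proof.
move=> [[q1x q2x] xmin].
have q1_cvg : qform A1 y @[y --> x] --> (1 : R).
  by rewrite -q1x; exact: qform_continuous.
have normalize_cvg : (Num.sqrt (qform A1 y))^-1 *: y @[y --> x] --> x.
  move: {1 2 3 5}(nbhs x) (nbhs_filter x) q1_cvg (@cvg_id _ (nbhs x)).
  move=> N FN q1_cvg Nx.
  rewrite -[X in _ --> X]scale1r -invr1; apply: cvgZ => //.
  apply: cvgV => //; rewrite -sqrtr1.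
  by apply: (continuous_cvg _ _ q1_cvg); exact: sqrt_continuous.
have q1_gt0 := cvgr_gt _ q1_cvg _ ltr01.
have xmin' := normalize_cvg _ xmin.
near=> y; have q1y : 0 < qform A1 y by near: y; exact: q1_gt0.
have : feasible A1 A2 ((Num.sqrt (qform A1 y))^-1 *: y) ->
    qform A0 x <= qform A0 ((Num.sqrt (qform A1 y))^-1 *: y).
  by near: y; exact: xmin'.
set s := Num.sqrt _ => ymin.
have s2 : s ^+ 2 = qform A1 y by rewrite sqr_sqrtr // ltW.
have s2_gt0 : 0 < s ^+ 2 by rewrite s2.
rewrite -scaleN1r -scaleNr !qform_lin => Gy.
have : qform A0 x <= qform A0 (s^-1 *: y).
  apply: ymin; split; rewrite qformZ exprVn.
    by rewrite -s2 mulVf // gt_eqF.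
  by rewrite ler_pdivrMl // mulr1 s2; lra.
by rewrite qformZ exprVn ler_pdivlMl // s2; lra.
Unshelve. all: by end_near. Qed.

End Local.

(** * Optimality conditions for the homogenised problem *)

Section Homogeneous.
Context {R : realType} {n : nat} (F G : 'M[R]_n) (x : 'cV[R]_n).
Hypotheses (symF : F^T = F) (symG : G^T = G).
Hypotheses (Fx0 : qform F x = 0) (Gx_le0 : qform G x <= 0).
Hypothesis locF : \forall y \near x, qform G y <= 0 -> 0 <= qform F y.
Hypothesis not_global : exists2 y, qform G y <= 0 & qform F y < 0.
Implicit Types (w z y : 'cV[R]_n).

(** Straight lines only reveal first-order information on a curved constraint;
    the second-order term of the curve [x + t w + t^2 z] leaves room to bend
    back into the feasible set.  Only small [t > 0] matter. *)
Definition feasible_curve w z :=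
  \forall t \near (0 : R)^'+, qform G (x + t *: (w + t *: z)) <= 0.

Lemma feasible_curve_ge0 w z : feasible_curve w z ->
  \forall t \near (0 : R)^'+, 0 <= qform F (x + t *: (w + t *: z)).
Proof.
move=> Gcurve; have locF' := @curve_cvg _ _ x w z _ locF.
near=> t; have Gt : qform G (x + t *: (w + t *: z)) <= 0 by near: t.
by move: Gt; near: t.
Unshelve. all: by end_near. Qed.

Lemma first_order_necessary w z : feasible_curve w z -> 0 <= dot (F *m x) w.
Proof.
move=> /feasible_curve_ge0 Ft; suff : 0 <= 2 * dot (F *m x) w by lra.
apply: (@germ_ge0 _ _ (qform F w + 2 * dot (F *m x) z)
  (2 * dot (F *m w) z) (qform F z) 0).
near=> t; have t0 : 0 < t by near: t; exact: nbhs_right_gt.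
rewrite -(pmulr_rge0 _ t0).
have : 0 <= qform F (x + t *: (w + t *: z)) by near: t.
by rewrite qform_curve // Fx0; congr (0 <= _); ring.
Unshelve. all: by end_near. Qed.

Lemma second_order_necessary w z : feasible_curve w z -> dot (F *m x) w = 0 ->
  0 <= qform F w + 2 * dot (F *m x) z.
Proof.
move=> /feasible_curve_ge0 Ft Fw0.
apply: (@germ_ge0 _ _ (2 * dot (F *m w) z) (qform F z) 0 0).
near=> t; have t0 : 0 < t by near: t; exact: nbhs_right_gt.
rewrite -(pmulr_rge0 _ (exprn_gt0 2 t0)).
have : 0 <= qform F (x + t *: (w + t *: z)) by near: t.
by rewrite qform_curve // Fx0 Fw0; congr (0 <= _); ring.
Unshelve. all: by end_near. Qed.

(** A form takes the same value at [w] and [- w], so a direction feasible in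
    both senses kills the linear term of [F] and leaves its quadratic one. *)
Lemma two_sided_necessary w : feasible_curve w 0 -> feasible_curve (- w) 0 ->
  dot (F *m x) w = 0 /\ 0 <= qform F w.
Proof.
move=> cw cNw; have Fw : dot (F *m x) w = 0.
  have := first_order_necessary cw; have := first_order_necessary cNw.
  by rewrite -scaleN1r dotZr; lra.
split=> //; have := second_order_necessary cw Fw.
by rewrite -[X in dot _ X](scale0r 0) dotZr mul0r mulr0 addr0.
Qed.

Lemma feasible_curve_interior w z : qform G x < 0 -> feasible_curve w z.
Proof.
move=> Gx; near=> t; apply: ltW; rewrite qform_curve //; near: t.
exact: germ_lt0.
Unshelve. all: by end_near. Qed.

(** If the constraint were inactive, every direction would be feasible and [F]
    would be nonnegative everywhere: local minimality would be global. *)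
Lemma constraint_active : qform G x = 0.
Proof.
apply/eqP; rewrite eq_le Gx_le0 leNgt; apply/negP => Gx.
have [y _] := not_global; rewrite ltNge => /negP; apply.
by case: (@two_sided_necessary y) => //; exact: feasible_curve_interior.
Qed.

(** If the gradient of the constraint vanished at [x], then
    [qform G (x + t w) = t^2 qform G w], so every [w] with [qform G w <= 0]
    would be feasible in both senses and [qform F w >= 0]: again [x] would be
    global. *)
Lemma constraint_normal_neq0 : G *m x != 0.
Proof.
apply/eqP => Gx0; have [y Gy] := not_global; rewrite ltNge => /negP; apply.
have cy w : qform G w <= 0 -> feasible_curve w 0.
  move=> Gw; near=> t; rewrite scaler0 addr0 qformD // constraint_active Gx0.
  rewrite dot0l qformZ mulr0 !add0r.
  by rewrite mulr_ge0_le0 // sqr_ge0.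
by case: (@two_sided_necessary y) => //; apply: cy; rewrite ?qformN.
Unshelve. all: by end_near. Qed.

Lemma feasible_curve_descent w z : dot (G *m x) w < 0 -> feasible_curve w z.
Proof.
move=> Gw; near=> t; have t0 : 0 < t by near: t; exact: nbhs_right_gt.
rewrite qform_curve // constraint_active.
suff : 2 * dot (G *m x) w + t * (qform G w + 2 * dot (G *m x) z)
  + t ^+ 2 * (2 * dot (G *m w) z) + t ^+ 3 * qform G z + t ^+ 4 * 0 < 0.
  rewrite -(pmulr_rlt0 _ t0) => /ltW; congr (_ <= _); ring.
by near: t; apply: germ_lt0; lra.
Unshelve. all: by end_near. Qed.

Lemma feasible_curve_tangent w z : dot (G *m x) w = 0 ->
  qform G w + 2 * dot (G *m x) z < 0 -> feasible_curve w z.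
Proof.
move=> Gw Gz; near=> t; have t0 : 0 < t by near: t; exact: nbhs_right_gt.
rewrite qform_curve // constraint_active Gw.
suff : qform G w + 2 * dot (G *m x) z
  + t * (2 * dot (G *m w) z) + t ^+ 2 * qform G z + t ^+ 3 * 0 + t ^+ 4 * 0 < 0.
  rewrite -(pmulr_rlt0 _ (exprn_gt0 2 t0)) => /ltW; congr (_ <= _); ring.
by near: t; apply: germ_lt0.
Unshelve. all: by end_near. Qed.

(** Second-order necessary condition.  A tangent direction [w] alone need not be
    feasible, since [qform G w] may be positive, and it is not optimal to leave
    the boundary when [qform G w] is negative.  Bending the curve along the
    normal [p = G x] by [z] compensates [qform G w] up to an error as small as
    desired, and [F x = - b p] turns [2 dot (F x) z] into [b * qform G w]. *)
Lemma lagrangian_tangent_ge0 b w : 0 < b -> (F + b *: G) *m x = 0 ->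
  dot (G *m x) w = 0 -> 0 <= qform (F + b *: G) w.
Proof.
move=> b0 Hx Gw.
have FxE : F *m x = - b *: (G *m x).
  by apply/eqP; rewrite scaleNr scalemxAl -addr_eq0 -mulmxDl Hx.
set p := G *m x in Gw FxE *.
have pp : 0 < dot p p by rewrite dot_gt0 constraint_normal_neq0.
rewrite qform_lin leNgt; apply/negP => H_lt0.
(* A violation of the second-order condition asks for
   [qform F w / b < 2 dot p z] and feasibility for [2 dot p z < - qform G w];
   [s] is the midpoint of the interval that this leaves for [dot p z]. *)
pose s := (qform F w - b * qform G w) / (2 * b * 2).
pose z := (s / dot p p) *: p.
have pz : dot p z = s by rewrite dotZr divfK // gt_eqF.
have bs : 2 * b * 2 * s = qform F w - b * qform G w.
  by rewrite /s mulrC divfK // gt_eqF //; lra.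
have cz : feasible_curve w z.
  apply: feasible_curve_tangent => //; rewrite -/p pz -(pmulr_rlt0 _ b0); lra.
have := second_order_necessary cz; rewrite FxE !dotZl Gw mulr0 => /(_ erefl).
rewrite pz; lra.
Qed.

(** The multiplier cannot be 0: otherwise [F x = 0], so that [F] is nonnegative
    on the open half-space of descent directions of the constraint, hence on all
    directions by parity and closure, and [x] would be global. *)
Lemma multiplier_gt0 : exists2 b, 0 < b & (F + b *: G) *m x = 0.
Proof.
have [b b0 FbG] : exists2 b, 0 <= b & F *m x + b *: (G *m x) = 0.
  apply: halfspace_multiplier constraint_normal_neq0 _ => h Gh.
  exact: first_order_necessary (feasible_curve_descent 0 Gh).
exists b; last by rewrite mulmxDl -scalemxAl.
rewrite lt_neqAle b0 andbT; apply/eqP => b_eq0; move: FbG.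
rewrite -b_eq0 scale0r addr0 => Fx.
have [y _] := not_global; rewrite ltNge => /negP; apply.
wlog py : y / dot (G *m x) y <= 0.
  move=> hw; have [/hw //|py] := leP (dot (G *m x) y) 0.
  by rewrite -qformN; apply: hw; rewrite -scaleN1r dotZr; lra.
pose p := G *m x.
have pp : 0 < dot p p by rewrite dot_gt0 constraint_normal_neq0.
apply: (@germ_ge0 _ _ (- 2 * dot (F *m y) p) (qform F p) 0 0).
near=> t; have t0 : 0 < t by near: t; exact: nbhs_right_gt.
have Gyt : dot (G *m x) (y + (- t) *: p) < 0.
  have := mulr_gt0 t0 pp; rewrite dotDr dotZr -/p in py *; lra.
have := second_order_necessary (feasible_curve_descent 0 Gyt).
rewrite Fx !dot0l mulr0 addr0 => /(_ erefl).
by rewrite qformD // qformZ dotZr; congr (0 <= _); ring.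
Unshelve. all: by end_near. Qed.

End Homogeneous.

(** * Counting negative eigenvalues of a real symmetric matrix *)

Section Spectral.
Local Open Scope sesquilinear_scope.
Context {R : realType} {n : nat}.
Local Notation C := (complex R).
Local Notation toC := (real_complex R).
Local Notation "A ^%C" := (map_mx toC A) (at level 2, format "A ^%C").
Implicit Types (H : 'M[R]_n) (P : 'M[C]_n) (a b d : 'rV[R]_n) (z c : 'rV[C]_n).

Lemma conj_toC (r : R) : (toC r)^* = toC r.
Proof. exact: conjc_real. Qed.

Lemma rect_row z : exists a, exists b, z = a^%C + 'i *: b^%C.
Proof.
exists (map_mx (@complex.Re R) z), (map_mx (@complex.Im R) z).
by apply/rowP => i; rewrite !mxE [LHS]complexE complexiE.
Qed.

(** The Hermitian extension of a real form splits over real and imaginary parts,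
    the cross terms cancelling by symmetry.  This transfers sign conditions
    between the real form and its unitary diagonalization. *)
Lemma hermitian_form_rect H a b : H^T = H -> let z := a^%C + 'i *: b^%C in
  (z *m H^%C *m z^t*) 0 0 = toC (qform H a^T + qform H b^T).
Proof.
move=> sH z.
have formC (u v : 'rV[R]_n) : (u^%C *m H^%C *m v^%C^T) 0 0
    = toC ((u *m H *m v^T) 0 0).
  by rewrite map_trmx -!map_mxM mxE.
have cross : (b *m H *m a^T) 0 0 = (a *m H *m b^T) 0 0.
  have -> : b *m H *m a^T = (a *m H *m b^T)^T.
    by rewrite !trmx_mul trmxK sH mulmxA.
  by rewrite mxE.
have zE : z^t* = a^%C^T - 'i *: b^%C^T.
  apply/matrixP => i j; rewrite !mxE rmorphD rmorphM /= conjCi !conj_toC.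
  by rewrite mulNr.
rewrite zE /z !(mulmxDl, mulmxBr, mulmxDr) -!(scalemxAl, scalemxAr) scalerA.
have entry (X Y Z W : 'M[C]_1) :
    (X + 'i *: Y - ('i *: Z + ('i * 'i) *: W)) 0 0
    = X 0 0 + W 0 0 + 'i * (Y 0 0 - Z 0 0).
  by rewrite !mxE -expr2 sqrCi; ring.
by rewrite entry !formC cross subrr mulr0 addr0 /qform !trmxK rmorphD.
Qed.

Lemma orthogonal_rect (p : 'cV[R]_n) a b :
  (a^%C + 'i *: b^%C) *m p^%C = 0 -> a *m p = 0 /\ b *m p = 0.
Proof.
rewrite mulmxDl -scalemxAl -!map_mxM => /matrixP ab0.
suff ab i j : (a *m p) i j = 0 /\ (b *m p) i j = 0.
  by split; apply/matrixP => i j; rewrite [RHS]mxE; case: (ab i j).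
have := ab0 i j; rewrite [LHS]mxE [X in X + _]mxE [X in _ + X]mxE.
rewrite [X in _ * X]mxE [RHS]mxE -complexiE => /eqP; rewrite eq_complex /=.
by rewrite !(mul0r, mul1r, mulr0, addr0, add0r, subr0) => /andP[/eqP-> /eqP->].
Qed.

Lemma real_spectral H : H^T = H -> exists P, exists d,
  P \is unitarymx /\ H^%C = P^t* *m diag_mx d^%C *m P.
Proof.
move=> sH; have Hherm : H^%C \is hermsymmx.
  apply: realsym_hermsym; last first.
    apply/mxOverP => i j; rewrite mxE complex_real //.
  by apply/is_hermitianmxP; rewrite expr0 scale1r map_mx_id // map_trmx sH.
pose D := spectral_diag H^%C; pose d : 'rV[R]_n := map_mx (@complex.Re R) D.
exists (spectralmx H^%C), d; split; first exact: spectral_unitarymx.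
have -> : d^%C = D.
  apply/rowP => i; rewrite !mxE; apply: RRe_real.
  by move/mxOverP: (hermitian_spectral_diag_real Hherm).
rewrite -invmx_unitary ?spectral_unitarymx //.
exact/orthomx_spectralP/hermitian_normalmx.
Qed.

Lemma char_poly_real_spectral H P d : P \is unitarymx ->
  H^%C = P^t* *m diag_mx d^%C *m P ->
  char_poly H = \prod_(a <- [seq d 0 i | i <- enum 'I_n]) ('X - a%:P).
Proof.
move=> uP HE; apply: (@map_inj_poly _ _ toC) => [r s []//|//|].
rewrite map_char_poly HE.
have PtP : P^t* *m P = 1%:M by apply: mulmx1C; apply/unitarymxP.
have -> : char_poly (P^t* *m diag_mx d^%C *m P) = char_poly (diag_mx d^%C).
  rewrite /char_poly /char_poly_mx !map_mxM.
  have {1}-> : 'X%:M = map_mx polyC (P^t*) *m 'X%:M *m map_mx polyC P.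
    by rewrite mul_mx_scalar -scalemxAl -map_mxM PtP map_mx1 scalemx1.
  rewrite -mulmxBl -mulmxBr !det_mulmx mulrAC -det_mulmx -map_mxM PtP map_mx1.
  by rewrite det1 mul1r.
rewrite char_poly_trig ?diag_mx_is_trig // rmorph_prod /= big_map big_enum /=.
apply: eq_bigr => i _.
by rewrite rmorphB /= map_polyX map_polyC /= !mxE eqxx mulr1n.
Qed.

Lemma hermitian_form_diag H P d c : P \is unitarymx ->
  H^%C = P^t* *m diag_mx d^%C *m P -> let z := c *m P in
  (z *m H^%C *m z^t*) 0 0 = \sum_i toC (d 0 i) * `|c 0 i| ^+ 2.
Proof.
move=> uP -> z; have PP : P *m P^t* = 1%:M by apply/unitarymxP.
rewrite /z trmx_mul map_mxM /= !mulmxA -(mulmxA c) PP mulmx1.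
rewrite -(mulmxA _ P) PP mulmx1 mxE; apply: eq_bigr => i _.
rewrite mul_mx_diag !mxE normCK; ring.
Qed.

(** Two negative eigenvalues would make the form negative on a plane, which
    meets the hyperplane orthogonal to [p] in a nonzero vector; no negative
    eigenvalue would make it nonnegative. *)
Lemma one_negative_eigenvalue H (p : 'cV[R]_n) : H^T = H ->
  (forall w, dot p w = 0 -> 0 <= qform H w) -> (exists v, qform H v < 0) ->
  num_neg_eigenvalues H 1.
Proof.
move=> sH Hp [v Hv]; have [P [d [uP HE]]] := real_spectral sH.
exists [seq d 0 i | i <- enum 'I_n]; first exact: char_poly_real_spectral uP HE.
rewrite count_map -sum1_count big_enum_cond /= sum1_card.
have PtP : P^t* *m P = 1%:M by apply: mulmx1C; apply/unitarymxP.
have diag_ge0 c : c *m P *m p^%C = 0 ->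
    0 <= \sum_i toC (d 0 i) * `|c 0 i| ^+ 2.
  rewrite -(hermitian_form_diag c uP HE).
  have [a [b zE]] := rect_row (c *m P); rewrite zE => /orthogonal_rect [ap bp].
  rewrite hermitian_form_rect // ler0c addr_ge0 //.
    by apply: Hp; rewrite dotC /dot trmxK ap mxE.
  by apply: Hp; rewrite dotC /dot trmxK bp mxE.
have [i di] : exists i, d 0 i < 0.
  apply: contrapT => d_ge0; move: Hv; apply/negP; rewrite -leNgt.
  rewrite -ler0c.
  have := @hermitian_form_rect H v^T 0 sH.
  rewrite map_mx0 scaler0 addr0 trmxK trmx0 /= (qformE H 0) mulmx0 dot0l.
  rewrite addr0 => <-; have -> : v^T^%C = (v^T^%C *m P^t*) *m P.
    by rewrite -mulmxA PtP mulmx1.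
  rewrite (hermitian_form_diag _ uP HE) sumr_ge0 // => k _.
  rewrite mulr_ge0 ?exprn_ge0 // ler0c leNgt.
  by apply/negP => dk; apply: d_ge0; exists k.
apply/eqP; rewrite eqn_leq; apply/andP; split; last first.
  by apply/card_gt0P; exists i.
apply/card_le1_eqP => {di}i j; rewrite !unfold_in /= => di dj.
apply/eqP; apply: contraT => ij.
pose u := P *m p^%C.
have negC k : d 0 k < 0 -> toC (d 0 k) < 0.
  by move=> dk; rewrite (ltcR _ 0).
(* In the basis of eigenvectors [p] has coordinates [u], so that
   [u j *: e_i - u i *: e_j] is orthogonal to it; this vector is nonzero when
   [u i] is, and otherwise [e_i] itself is orthogonal to [p]. *)
have [ui|ui] := eqVneq (u i 0) 0.
  have := @diag_ge0 (delta_mx 0 i); rewrite -mulmxA -/u -rowE.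
  have -> : row i u = 0.
    by apply/matrixP => k l; rewrite [LHS]mxE [RHS]mxE !ord1 ui.
  move=> /(_ erefl); rewrite (bigD1 i) //= big1 => [|k ki]; last first.
    by rewrite mxE (negbTE ki) andbF normr0 expr0n mulr0.
  by rewrite mxE !eqxx normr1 expr1n mulr1 addr0 lt_geF ?negC.
have := @diag_ge0 (u j 0 *: delta_mx 0 i - u i 0 *: delta_mx 0 j).
rewrite -mulmxA -/u mulmxBl -!scalemxAl -!rowE.
have -> : u j 0 *: row i u - u i 0 *: row j u = 0.
  apply/matrixP => k l; rewrite [LHS]mxE [X in X + _]mxE [RHS]mxE.
  rewrite [X in _ + X]mxE [X in _ - X]mxE [X in _ * X]mxE.
  by rewrite [X in _ - _ * X]mxE !ord1 mulrC subrr.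
move=> /(_ erefl); move: (u i 0) (u j 0) ui => {u} ui uj ui0.
rewrite (bigD1 i) //= (bigD1 j) //=.
rewrite big1 => [|k /andP[ki kj]]; last first.
  rewrite !mxE (negbTE ki) (negbTE kj) !andbF !mulr0 subrr.
  by rewrite normr0 expr0n mulr0.
rewrite !mxE !eqxx [i == j]eq_sym (negbTE ij) /= !mulr1 !mulr0 subr0 sub0r.
rewrite addr0 normrN lt_geF //.
rewrite ltr_wnDl // ?nmulr_rlt0 ?negC ?exprn_gt0 ?normr_gt0 //.
by rewrite mulr_le0_ge0 ?exprn_ge0 // ltW // negC.
Qed.

End Spectral.

Theorem theorem4p2 (R : realType) (n : nat) (hn : (3 <= n)%N)
    (A0 A1 A2 : 'M[R]_n)
    (sym0 : A0^T = A0) (sym1 : A1^T = A1) (sym2 : A2^T = A2)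
    (hpd : exists mu1 mu2 : R, posdefmx (mu1 *: A1 + mu2 *: A2))
    (hslater : exists x0 : 'cV[R]_n, qform A1 x0 = 1 /\ qform A2 x0 < 1)
    (x : 'cV[R]_n)
    (hx : local_nonglobal_minimizer (qform A0) (feasible A1 A2) x) :
  (exists alpha beta : R, 0 < beta /\ kkt A0 A1 A2 x alpha beta) /\
  (forall alpha beta : R, 0 < beta -> kkt A0 A1 A2 x alpha beta ->
     num_neg_eigenvalues (A0 + alpha *: A1 + beta *: A2) 1).
Proof.
case: hx => xloc xnonglob; have [[q1x q2x] _] := xloc.
pose F := A0 - qform A0 x *: A1; pose G := A2 - A1.
have FE y : qform F y = qform A0 y - qform A0 x * qform A1 y.
  by rewrite /F -scaleNr qform_lin mulNr.
have GE y : qform G y = qform A2 y - qform A1 y.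
  by rewrite /G -scaleN1r qform_lin mulN1r.
have symF : F^T = F by rewrite linearB linearZ /= sym0 sym1.
have symG : G^T = G by rewrite linearB /= sym1 sym2.
have Fx0 : qform F x = 0 by rewrite FE q1x mulr1 subrr.
have Gx_le0 : qform G x <= 0 by rewrite GE q1x subr_le0.
have Floc := local_minimizer_homogeneous xloc.
have [y Gy Fy] : exists2 y, qform G y <= 0 & qform F y < 0.
  apply: contrapT => Fge0; apply: xnonglob; split=> // y [q1y q2y].
  rewrite leNgt; apply/negP => q0y; apply: Fge0; exists y.
    by rewrite GE q1y subr_le0.
  by rewrite FE q1y mulr1 subr_lt0.
have not_global : exists2 y, qform G y <= 0 & qform F y < 0 by exists y.
have pencilE b : A0 + (- qform A0 x - b) *: A1 + b *: A2 = F + b *: G.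
  rewrite /F /G scalerBl scaleNr scalerBr !addrA.
  by rewrite -!addrA; congr (_ + (_ + _)); rewrite addrC.
split.
  have [b b0 Hx] := multiplier_gt0 symF symG Fx0 Gx_le0 Floc not_global.
  have q2x1 : qform A2 x = 1.
    have := constraint_active symF symG Fx0 Gx_le0 Floc not_global.
    by rewrite GE q1x => /eqP; rewrite subr_eq0 => /eqP.
  exists (- qform A0 x - b), b; split=> //.
  by split; rewrite ?pencilE ?q2x1 ?subrr ?mulr0.
move=> a b b0 [Hx _ _ compl].
have q2x1 : qform A2 x = 1.
  by apply/eqP; rewrite -subr_eq0; move/eqP: compl; rewrite mulf_eq0 gt_eqF.
(* Evaluating the stationarity equation at [x] determines [a] from [b], and the
   Lagrangian matrix becomes [F + b *: G]. *)
have aE : a = - qform A0 x - b.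
  have : qform (A0 + a *: A1 + b *: A2) x = 0 by rewrite qformE Hx dot0l.
  by rewrite !qform_lin q1x q2x1; lra.
rewrite aE pencilE in Hx *.
apply: (@one_negative_eigenvalue _ _ _ (G *m x)).
- by rewrite linearD linearZ /= symF symG.
- move=> w; exact: lagrangian_tangent_ge0 b0 Hx.
- exists y; rewrite qform_lin.
  have := mulr_ge0_le0 (ltW b0) Gy; lra.
Qed.
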